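(* (i) For $m\in\mathbb Z_+$, $$P_m(k_1^{-1}u_1^{-1})=k_1^{-m}u_1^{-m}\frac{\bigl(-qk_1^2,\,q^{1/2}k_0k_1u_0u_1,\,-q^{1/2}k_0k_1u_0^{-1}u_1;q\bigr)_m}{\bigl(q^{m+1}k_0^2k_1^2;q\bigr)_m}=a^{-m}\frac{(qab,ac,ad;q)_m}{(q^mabcd;q)_m}.$$ (ii) For $m\in\mathbb N$, $$P_{-m}(k_1^{-1}u_1^{-1})=\frac{k_1^{-m}u_1^{-m}}{1+k_1^{-2}}\frac{\bigl(-k_1^2,\,q^{1/2}k_0k_1u_0u_1,\,-q^{1/2}k_0k_1u_0^{-1}u_1;q\bigr)_m}{\bigl(q^{m}k_0^2k_1^2;q\bigr)_m}=\frac{a^{-m}}{1-a^{-1}b^{-1}}\frac{(ab,ac,ad;q)_m}{(q^{m-1}abcd;q)_m}.$$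
   Context: $\mathbb Z_+=\{0,1,2,\dots\}$, $\mathbb N=\{1,2,\dots\}$; $(y;q)_m=\prod_{j=0}^{m-1}(1-yq^j)$, $(y_1,\dots,y_r;q)_m=\prod_i(y_i;q)_m$. Parameters: $q\in\mathbb C\setminus\{0\}$ with $|q|\ne1$ and a fixed square root $q^{1/2}$; $\underline t=(k_0,k_1,u_0,u_1)$ nonzero complex numbers with $k_0^2,k_1^2,u_1^2\notin\{\pm q^j:j\in\mathbb Z\}$. Set $a=k_1u_1$, $b=-k_1u_1^{-1}$, $c=q^{1/2}k_0u_0$, $d=-q^{1/2}k_0u_0^{-1}$. $\mathcal A=\mathbb C[x^{\pm1}]$. Define linear operators on $\mathcal A$ by $(T_1f)(x)=k_1f(x)+k_1^{-1}\frac{(1-k_1u_1x)(1+k_1u_1^{-1}x)}{1-x^2}\bigl(f(x^{-1})-f(x)\bigr)$ and $(T_0f)(x)=k_0f(x)+k_0^{-1}\frac{(1-q^{1/2}k_0u_0x^{-1})(1+q^{1/2}k_0u_0^{-1}x^{-1})}{1-qx^{-2}}\bigl(f(qx^{-1})-f(x)\bigr)$, and put $Y=T_1T_0$. Let $\epsilon(m)=1$ for $m\ge0$, $\epsilon(m)=-1$ for $m<0$, $\gamma_m=(k_0k_1)^{\epsilon(m)}q^m$. Order the monomials by $1\prec x^{-1}\prec x\prec x^{-2}\prec x^2\prec\cdots$. The monic non-symmetric Askey-Wilson polynomial $P_m$ ($m\in\mathbb Z$) is the unique Laurent polynomial of the form $x^m+$ lower order terms w.r.t. $\preceq$ with $YP_m=\gamma_mP_m$.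 *)

(* Defs.v *)
From mathcomp Require Import all_boot all_order all_algebra.
From mathcomp Require Import boolp classical_sets finmap.
From mathcomp Require Import ring zify.
From mathcomp Require Import monalg.

Set Implicit Arguments.
Unset Strict Implicit.
Unset Printing Implicit Defensive.

Import Order.TTheory GRing.Theory Num.Theory.
Local Open Scope ring_scope.

(* Laurent polynomials are finitely supported families of coefficients
   indexed by int: P@_j is the coefficient of x^j. *)
Notation laurent F := {malg F[int]}.

Notation ratfun F := {fraction {poly F}}.

Section Laurent.
Context {F : fieldType}.

Definition leval (P : laurent F) (z : F) : F :=
  mmap idfun (fun j : int => z ^ j) P.

Definition ratC : F -> ratfun F := @FracField.tofrac {poly F} \o polyC.

Definition ratX : ratfun F := FracField.tofrac 'X.

(* f(r), a rational function; [lsubst f ratX] is f itself, viewed in F(x). *)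
Definition lsubst (f : laurent F) (r : ratfun F) : ratfun F :=
  mmap ratC (fun j : int => r ^ j) f.

(* The Laurent polynomial equal to the rational function r (0 if there is
   none); see [lsubstX_inj], [T1E] and [T0E] below. *)
Definition to_laurent (r : ratfun F) : laurent F :=
  xget 0 [set f : laurent F | lsubst f ratX = r].

Definition T1 (k1 u1 : F) (f : laurent F) : laurent F :=
  to_laurent
    (ratC k1 * lsubst f ratX +
     ratC k1^-1 *
       ((1 - ratC (k1 * u1) * ratX) * (1 + ratC (k1 / u1) * ratX) /
        (1 - ratX ^+ 2)) *
       (lsubst f ratX^-1 - lsubst f ratX)).

(* qh stands for q^{1/2} *)
Definition T0 (qh k0 u0 : F) (f : laurent F) : laurent F :=
  let q := qh ^+ 2 in
  to_laurent
    (ratC k0 * lsubst f ratX +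
     ratC k0^-1 *
       ((1 - ratC (qh * k0 * u0) * ratX^-1) *
        (1 + ratC (qh * k0 / u0) * ratX^-1) /
        (1 - ratC q * ratX ^- 2)) *
       (lsubst f (ratC q * ratX^-1) - lsubst f ratX)).

Definition Yop (qh k0 k1 u0 u1 : F) (f : laurent F) : laurent F :=
  T1 k1 u1 (T0 qh k0 u0 f).

Definition spectral (q k0 k1 : F) (m : int) : F :=
  (if (0 <= m)%R then k0 * k1 else (k0 * k1)^-1) * q ^ m.

(* x^j strictly precedes x^m in 1, x^-1, x, x^-2, x^2, ... *)
Definition mon_lt (j m : int) : bool :=
  (`|j| < `|m|) || (`|j| == `|m|) && (j < m).

Definition monic_at (m : int) (P : laurent F) : Prop :=
  P@_m = 1 /\ forall j : int, P@_j != 0 -> j = m \/ mon_lt j m.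

(* P is the m-th monic non-symmetric Askey-Wilson polynomial: [unique] makes P
   the only monic solution. For special parameters (some spectral values
   coinciding) there is no unique solution, and then no P satisfies this. *)
Definition is_nsAW (qh k0 k1 u0 u1 : F) (m : int) : laurent F -> Prop :=
  unique (fun P =>
    monic_at m P /\
    Yop qh k0 k1 u0 u1 P = spectral (qh ^+ 2) k0 k1 m *: P).

Definition qpoch (q y : F) (m : nat) : F := \prod_(j < m) (1 - y * q ^+ j).

Definition qpoch3 (q y1 y2 y3 : F) (m : nat) : F :=
  qpoch q y1 m * qpoch q y2 m * qpoch q y3 m.

Definition avoids_qpowers (q y : F) : Prop :=
  forall j : int, y != q ^ j /\ y != - q ^ j.

(* Well-definedness of [to_laurent], T1 and T0. *)

Let sub_div_neq0 (K : fieldType) (x c : K) :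
  x != 0 -> x ^+ 2 != c -> c * x^-1 - x != 0.
Proof.
move=> x0; apply: contra; rewrite subr_eq0 => /eqP e.
by rewrite expr2 -[X in X * _]e divfK.
Qed.

Let quot_neg (K : fieldType) (x y : K) (n : nat) : x != 0 -> y != 0 ->
  (y ^ Negz n - x ^ Negz n) / (y - x) =
  - (y * x) ^- n.+1 * ((y ^+ n.+1 - x ^+ n.+1) / (y - x)).
Proof.
move=> x0 y0; rewrite -[y ^ _]/(y ^- n.+1) -[x ^ _]/(x ^- n.+1).
rewrite mulrA; congr (_ / _); rewrite exprMn.
have := expf_neq0 n.+1 y0; have := expf_neq0 n.+1 x0.
move: (x ^+ _) (y ^+ _) => a b a0 b0; by field; rewrite ?a0 ?b0.
Qed.

Let T1_quot (K : fieldType) (x A B d : K) : x != 0 -> 1 - x ^+ 2 != 0 ->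
  A * B / (1 - x ^+ 2) * d = A * (B * (x^-1 * (d / (x^-1 - x)))).
Proof.
move=> x0 d0; have -> : x^-1 - x = (1 - x ^+ 2) / x by field.
by rewrite invf_div; move: (1 - _) d0 => e e0; field; rewrite x0 e0.
Qed.

Let T0_quot (K : fieldType) (x c A B d : K) : x != 0 -> x ^+ 2 - c != 0 ->
  A * B / (1 - c * x ^- 2) * d =
  A * (B * (- 1 * (x * (d / (c * x^-1 - x))))).
Proof.
move=> x0 d0; have -> : c * x^-1 - x = - (x ^+ 2 - c) / x by field.
have -> : 1 - c * x ^- 2 = (x ^+ 2 - c) / x ^+ 2 by field.
by rewrite !invf_div; move: (_ - c) d0 => e e0; field; rewrite ?oppr_eq0 e0 ?x0.
Qed.

Let ratC_rmorph : {rmorphism F -> ratfun F} := ratC.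

Lemma ratC1 : ratC 1 = 1. Proof. exact: (rmorph1 ratC_rmorph). Qed.
Lemma ratCN c : ratC (- c) = - ratC c. Proof. exact: (rmorphN ratC_rmorph). Qed.
Lemma ratCM c d : ratC (c * d) = ratC c * ratC d.
Proof. exact: (rmorphM ratC_rmorph). Qed.
Lemma ratCV c : ratC c^-1 = (ratC c)^-1.
Proof. exact: (fmorphV ratC_rmorph). Qed.
Lemma ratCX c n : ratC (c ^+ n) = ratC c ^+ n.
Proof. exact: (rmorphXn ratC_rmorph). Qed.

Lemma ratX_neq0 : ratX != 0.
Proof. by rewrite /ratX tofrac_eq0 polyX_eq0. Qed.

Lemma ratC_neq0 (c : F) : c != 0 -> ratC c != 0.
Proof. by move=> c0; rewrite /ratC /= tofrac_eq0 polyC_eq0. Qed.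

Lemma lsubstE (d : {fset int}) (f : laurent F) (r : ratfun F) :
  (msupp f `<=` d)%fset -> lsubst f r = \sum_(j <- d) ratC f@_j * r ^ j.
Proof. exact: (@mmapEw _ _ _ ratC_rmorph). Qed.

Lemma lsubstB f g r : lsubst (f - g) r = lsubst f r - lsubst g r.
Proof. exact: (raddfB (mmap ratC_rmorph _)). Qed.

Lemma lsubstD f g r : lsubst (f + g) r = lsubst f r + lsubst g r.
Proof. exact: (raddfD (mmap ratC_rmorph _)). Qed.

Lemma lsubstU (c : F) (j : int) r : lsubst << c *g j >> r = ratC c * r ^ j.
Proof. exact: (@mmapU _ _ _ ratC_rmorph). Qed.


Lemma lsubstX_inj : injective (fun f : laurent F => lsubst f ratX).
Proof.
move=> f g /= eqfg; apply/eqP; rewrite -subr_eq0; apply/eqP.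
have: lsubst (f - g) ratX = 0 by rewrite lsubstB eqfg subrr.
move: (f - g) => {f g eqfg} h h0.
apply/malgP => k; rewrite mcoeff0.
case: (boolP (k \in msupp h)) => [kh|/mcoeff_outdom //].
pose N : nat := (\sum_(j <- msupp h) `|j|)%N.
have Nj j : j \in msupp h -> (0 <= N%:Z + j)%R.
  move=> jh; have : (`|j| <= N)%N by rewrite /N (big_rem j) //= leq_addr.
  by move=> H; lia.
pose p : {poly F} := \sum_(j <- msupp h) h@_j *: 'X^(`|(N%:Z + j)%R|%N).
have p0 : p = 0.
  apply/eqP; rewrite -tofrac_eq0; apply/eqP.
  rewrite -[RHS](mulr0 (ratX ^+ N)) -h0 (lsubstE _ (fsubset_refl _)).
  rewrite /p rmorph_sum /= mulr_sumr big_seq [RHS]big_seq.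
  apply: eq_bigr => j jh.
  rewrite -mul_polyC rmorphM rmorphXn /= mulrCA; congr (_ * _).
  rewrite -[X in X * _]/(ratX ^ N%:Z) -expfzDr ?ratX_neq0 //.
  by rewrite -[in RHS](gez0_abs (Nj _ jh)).
have := congr1 (fun p : {poly F} => p`_(`|(N%:Z + k)%R|%N)) p0.
rewrite coef0 /p coef_sum (big_rem k) //= coefZ coefXn eqxx mulr1.
rewrite big_seq big1 ?addr0 // => j jr.
have /andP[jk jh] : (j != k) && (j \in msupp h).
  by move: jr; rewrite mem_rem_uniq ?fset_uniq // inE.
rewrite coefZ coefXn; case: eqP => [/eqP e|]; last by rewrite mulr0.
case/negP: jk; apply/eqP.
have /eqP e' : (`|(N%:Z + k)%R|%N)%:Z == (`|(N%:Z + j)%R|%N)%:Z by rewrite eqz_nat.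
move: e'; rewrite !gez0_abs ?Nj // => e'; lia.
Qed.

Lemma to_laurentK (r : ratfun F) :
  (exists f : laurent F, lsubst f ratX = r) -> lsubst (to_laurent r) ratX = r.
Proof. by move=> h; rewrite /to_laurent; exact: (xgetPex _ h). Qed.

Let isL (r : ratfun F) := exists f : laurent F, lsubst f ratX = r.

Let isLD r s : isL r -> isL s -> isL (r + s).
Proof. by move=> [f <-] [g <-]; exists (f + g); rewrite lsubstD. Qed.

Let isL0 : isL 0.
Proof. by exists 0; rewrite -(subrr 0) lsubstB subrr. Qed.

Let isL_sum (I : Type) (s : seq I) (E : I -> ratfun F) :
  (forall i, isL (E i)) -> isL (\sum_(i <- s) E i).
Proof. by move=> h; elim/big_rec: _ => // i r _; apply: isLD. Qed.

Let isLmon (c : F) (j : int) r : isL r -> isL (ratC c * ratX ^ j * r).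
Proof.
move=> [f <-]; rewrite (lsubstE _ (fsubset_refl _)) mulr_sumr.
apply: isL_sum => i; exists << (c * f@_i) *g (j + i) >>.
rewrite lsubstU ratCM expfzDr ?ratX_neq0 //.
by rewrite mulrACA.
Qed.

Let isL1 : isL 1.
Proof. by exists << 1 *g 0 >>; rewrite lsubstU ratC1 mul1r. Qed.

Let isLC c : isL (ratC c).
Proof. by have := isLmon c 0 isL1; rewrite expr0z !mulr1. Qed.

Let isLCM c r : isL r -> isL (ratC c * r).
Proof. by move/(isLmon c 0); rewrite expr0z !mulr1. Qed.

Let isLM r s : isL r -> isL s -> isL (r * s).
Proof.
move=> [f <-] sL; rewrite (lsubstE _ (fsubset_refl _)) mulr_suml.
by apply: isL_sum => i; exact: isLmon.
Qed.

Let isLX (j : int) : isL (ratX ^ j).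
Proof. by exists << 1 *g j >>; rewrite lsubstU ratC1 mul1r. Qed.

Let isLexp r n : isL r -> isL (r ^+ n).
Proof. by move=> rL; elim: n => [|n IH]; rewrite ?exprS //; exact: isLM. Qed.

Let sqrX_neq c : ratX ^+ 2 != ratC c.
Proof.
rewrite /ratX /ratC /= -rmorphXn /= tofrac_eq; apply/eqP =>
  /(congr1 (fun p : {poly F} => size p)).
by rewrite size_polyXn size_polyC; case: (c != 0).
Qed.

Let isL_quot (c : F) (f : laurent F) : c != 0 ->
  isL ((lsubst f (ratC c * ratX^-1) - lsubst f ratX) /
       (ratC c * ratX^-1 - ratX)).
Proof.
move=> c0; set y := ratC c * ratX^-1.
have X0 := ratX_neq0; have C0 := ratC_neq0 c0.
have y0 : y != 0 := mulf_neq0 C0 (invr_neq0 X0).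
have yL : isL y by rewrite /y -exprN1; exact/isLCM/isLX.
have d0 : y - ratX != 0 := sub_div_neq0 X0 (sqrX_neq c).
have nonneg (n : nat) : isL ((y ^+ n - ratX ^+ n) / (y - ratX)).
  rewrite subrXX mulrAC mulfV // mul1r; apply: isL_sum => i.
  by apply: isLM; [exact: isLexp | exact: isLX i%:Z].
rewrite !(lsubstE _ (fsubset_refl _)) -sumrB mulr_suml; apply: isL_sum => j.
rewrite -mulrBr -mulrA; apply: isLCM.
case: j => n; first exact: nonneg.
have -> : (y ^ Negz n - ratX ^ Negz n) / (y - ratX) =
  ratC ((- c ^- n.+1)) * ((y ^+ n.+1 - ratX ^+ n.+1) / (y - ratX)).
  rewrite (_ : ratC (- c ^- n.+1) = - (y * ratX) ^- n.+1); last first.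
    by rewrite [y * _](divfK X0) ratCN ratCV ratCX.
  exact: (quot_neg n X0 y0).
exact/isLCM/nonneg.
Qed.

Lemma T1E (k1 u1 : F) (f : laurent F) :
  lsubst (T1 k1 u1 f) ratX =
    ratC k1 * lsubst f ratX +
    ratC k1^-1 *
      ((1 - ratC (k1 * u1) * ratX) * (1 + ratC (k1 / u1) * ratX) /
       (1 - ratX ^+ 2)) *
      (lsubst f ratX^-1 - lsubst f ratX).
Proof.
apply: to_laurentK; rewrite -/(isL _).
have lin c : isL (1 + ratC c * ratX).
  by apply: isLD => //; apply: isLCM; exact: isLX 1.
have Q := isL_quot f (oner_neq0 F).
rewrite ratC1 /= mul1r in Q.
have X0 := ratX_neq0.
have D0 : 1 - ratX ^+ 2 != 0.
  by have := sqrX_neq 1; rewrite ratC1 subr_eq0 eq_sym.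
apply: isLD; first by apply: isLCM; exists f.
rewrite -mulrA; apply: isLCM.
rewrite -[ratC (k1 * u1)]opprK -ratCN mulNr opprK /=.
set A := 1 + _; set B := 1 + _; set d := _ - _ in Q *.
rewrite (T1_quot _ _ _ X0 D0).
do 2!(apply: isLM; first exact: lin).
by apply: isLM => //; exact: (isLX (-1)).
Qed.

Lemma T0E (qh k0 u0 : F) (f : laurent F) : qh != 0 ->
  lsubst (T0 qh k0 u0 f) ratX =
    ratC k0 * lsubst f ratX +
    ratC k0^-1 *
      ((1 - ratC (qh * k0 * u0) * ratX^-1) *
       (1 + ratC (qh * k0 / u0) * ratX^-1) /
       (1 - ratC (qh ^+ 2) * ratX ^- 2)) *
      (lsubst f (ratC (qh ^+ 2) * ratX^-1) - lsubst f ratX).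
Proof.
move=> qh0; apply: to_laurentK; rewrite -/(isL _).
have lin c : isL (1 + ratC c * ratX^-1).
  by apply: isLD => //; apply: isLCM; rewrite -exprN1.
have Q := isL_quot f (expf_neq0 2 qh0).
have X0 := ratX_neq0.
have D0 : ratX ^+ 2 - ratC (qh ^+ 2) != 0 by rewrite subr_eq0 sqrX_neq.
apply: isLD; first by apply: isLCM; exists f.
rewrite -mulrA; apply: isLCM.
rewrite -[ratC (qh * k0 * u0)]opprK -ratCN mulNr opprK /=.
set c := ratC (qh ^+ 2) in Q D0 *.
set A := 1 + _; set B := 1 + _; set d := _ - _ in Q *.
rewrite (T0_quot _ _ _ X0 D0) -ratC1 -ratCN.
do 2!(apply: isLM; first exact: lin).
by apply: isLCM; apply: isLM => //; exact: (isLX 1).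
Qed.

End Laurent.

(* Main.v *)
Require Import Defs.
From HB Require Import structures.
From mathcomp Require Import all_boot all_order all_algebra.
From mathcomp Require Import finmap reals complex monalg.
From mathcomp Require Import ring zify.

Import Order.TTheory GRing.Theory Num.Theory.
Local Open Scope ring_scope.

Set Implicit Arguments.
Unset Strict Implicit.
Unset Printing Implicit Defensive.

(* Put g_k = (ax, aq/x; q)_k, u_k = (1 - aq^k x) g_k and
   w_k = aq^(k+1) x^-1 u_k, so that g_(k+1) = u_k - w_k.  The family
   g_0, w_0, g_1, w_1, ... is triangular for the order 1, x^-1, x, x^-2, ...,
   and only g_0 = 1 survives at x = 1/a.  The equation Y P = gamma P, rewritten
   as T_0 P = gamma T_1^-1 P, is bidiagonal from this family to
   g_0, u_0, g_1, u_1, ...; hence the coefficient of g_0 in P is the leading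
   coefficient times a product of ratios.  No denominator vanishes: otherwise
   the truncated recursion would give a lower eigenvector with the same
   eigenvalue, against the uniqueness of P. *)

(** * Monomial shifts and evaluations of Laurent polynomials *)

Section MulMonomial.
Context {F : fieldType}.
Implicit Types (f g : laurent F) (i j : int).

Definition mulxz i f : laurent F :=
  \sum_(j <- msupp f) << f@_j *g (j + i) >>.

Lemma mcoeff_mulxz i f j : (mulxz i f)@_j = f@_(j - i).
Proof.
rewrite /mulxz raddf_sum /=.
rewrite (eq_bigr (fun l => f@_l *+ (l == j - i))); last first.
  by move=> l _; rewrite mcoeffU -[l == _](can_eq (addrK i)) subrK.
case: (boolP ((j - i) \in msupp f)) => [jf|jf].
  rewrite (big_rem (j - i)) //= eqxx mulr1n big_seq big1 ?addr0 // => l.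
  rewrite mem_rem_uniq ?fset_uniq // inE => /andP[/negbTE-> _].
  by rewrite mulr0n.
rewrite (mcoeff_outdom jf) big_seq big1 // => l lf.
by case: eqP => [e|_]; rewrite ?mulr0n //; rewrite e (negbTE jf) in lf.
Qed.
End MulMonomial.

(* Both [leval] and [lsubst] are instances of this evaluation; working in an
   abstract field K keeps [ring] and unification away from F(x). *)
Section Eval.
Context {F K : fieldType} (h : {rmorphism F -> K}).
Implicit Types (f g : laurent F) (r : K).

Definition lev f r : K := mmap h (fun j : int => r ^ j) f.

Lemma levD f g r : lev (f + g) r = lev f r + lev g r.
Proof. exact: (raddfD (mmap h _)). Qed.

Lemma levB f g r : lev (f - g) r = lev f r - lev g r.
Proof. exact: (raddfB (mmap h _)). Qed.

Lemma levZ c f r : lev (c *: f) r = h c * lev f r.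
Proof.
rewrite /lev (mmapEw (msuppZ_le _ _)) mmapE mulr_sumr.
by apply: eq_bigr => j _; rewrite mcoeffZ /= rmorphM mulrA.
Qed.

Lemma lev_mulxz i f r : r != 0 -> lev (mulxz i f) r = r ^ i * lev f r.
Proof.
move=> r0; rewrite /lev /mulxz raddf_sum /= [in RHS]mmapE mulr_sumr.
by apply: eq_bigr => j _; rewrite mmapU expfzDr // mulrA mulrC.
Qed.
End Eval.

(** * The Laurent polynomials g_k, u_k, w_k and their reflection symmetries *)

Section MulLinear.
Context {F : fieldType}.

Definition mul_linear (s : F) (f : laurent F) := f - s *: mulxz 1 f.

Fixpoint gpol_rec (a q : F) k : laurent F :=
  if k is k'.+1 then
    let u := mul_linear (a * q ^+ k') (gpol_rec a q k') in
    u - (a * q ^+ k) *: mulxz (-1) u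
  else << 1 *g 0 >>.
End MulLinear.

HB.lock Definition gpol {F : fieldType} (a q : F) k : laurent F :=
  gpol_rec a q k.

HB.lock Definition upol {F : fieldType} (a q : F) k : laurent F :=
  mul_linear (a * q ^+ k) (gpol a q k).

HB.lock Definition wpol {F : fieldType} (a q : F) k : laurent F :=
  (a * q ^+ k.+1) *: mulxz (-1) (upol a q k).

Section Basis.
Context {F : fieldType}.
Variables a q : F.
Local Notation gpol := (gpol a q).
Local Notation upol := (upol a q).
Local Notation wpol := (wpol a q).

Lemma gpol0 : gpol 0 = << 1 *g 0 >>.
Proof. by rewrite gpol.unlock. Qed.

Lemma upolE k : upol k = gpol k - (a * q ^+ k) *: mulxz 1 (gpol k).
Proof. by rewrite upol.unlock. Qed.

Lemma wpolE k : wpol k = (a * q ^+ k.+1) *: mulxz (-1) (upol k).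
Proof. by rewrite wpol.unlock. Qed.

Lemma gpolS k : gpol k.+1 = upol k - wpol k.
Proof. by rewrite wpolE upol.unlock gpol.unlock. Qed.

Section BasisEval.
Context {K : fieldType} (h : {rmorphism F -> K}).
Implicit Type r : K.
Local Notation lev := (lev h).

Lemma lev_gpol0 r : lev (gpol 0) r = 1.
Proof. by rewrite gpol0 /lev mmapU /= rmorph1 expr0z mulr1. Qed.

Lemma lev_upol k r : r != 0 ->
  lev (upol k) r = (1 - h a * h q ^+ k * r) * lev (gpol k) r.
Proof.
move=> r0; rewrite upolE levB levZ lev_mulxz //.
by rewrite rmorphM rmorphXn expr1z; ring.
Qed.

Lemma lev_wpol k r : r != 0 ->
  lev (wpol k) r = h a * h q ^+ k.+1 * r^-1 * lev (upol k) r.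
Proof.
by move=> r0; rewrite wpolE levZ lev_mulxz // rmorphM rmorphXn exprN1 mulrA.
Qed.

Lemma lev_gpolS k r : r != 0 ->
  lev (gpol k.+1) r = (1 - h a * h q ^+ k.+1 * r^-1) * lev (upol k) r.
Proof.
by move=> r0; rewrite gpolS levB lev_wpol // mulrBl mul1r.
Qed.

(** The substitution x -> q/x exchanges 1 - aq^k x and 1 - aq^(k+1)/x, the two factors that lead
    from g_k to g_(k+1). *)
Lemma gpol_sym k r : q != 0 -> r != 0 ->
  lev (gpol k) (h q * r^-1) = lev (gpol k) r.
Proof.
move=> q0 r0; have Q0 : h q != 0 by rewrite fmorph_eq0.
have qr0 : h q * r^-1 != 0 by rewrite mulf_neq0 ?invr_neq0.
elim: k => [|k IH]; first by rewrite !lev_gpol0.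
rewrite !lev_gpolS // !lev_upol // IH !exprS.
by move: (lev _ _) (h q ^+ k) => G Z; field; rewrite Q0 r0.
Qed.

(** u_k is 1 - ax times a product invariant under x -> 1/x. The cross-multiplied form avoids
    dividing by 1 - ax, which may vanish. *)
Lemma upol_sym k r : r != 0 ->
  (1 - h a * r) * lev (upol k) r^-1 = (1 - h a * r^-1) * lev (upol k) r.
Proof.
move=> r0; have ri0 : r^-1 != 0 by rewrite invr_neq0.
elim: k => [|k IH].
  by rewrite !lev_upol // !lev_gpol0 expr0 !mulr1 mulrC.
rewrite lev_upol // lev_gpolS // [in RHS]lev_upol // lev_gpolS // invrK.
move: IH; move: (lev _ _) (lev _ _) (h a) (_ ^+ _) => g f A Z IH.
transitivity ((1 - A * Z * r^-1) * (1 - A * Z * r) * ((1 - A * r) * f)).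
  by ring.
by rewrite IH; ring.
Qed.
End BasisEval.
End Basis.

(** * Action of T_0 and T_1 on these families, at a point of an abstract field *)

Section AbstractOperators.
Context {F K : fieldType} (h : {rmorphism F -> K}).
Variables qh k0 k1 u0 u1 : F.
Hypotheses (qh0 : qh != 0) (k00 : k0 != 0) (k10 : k1 != 0)
           (u00 : u0 != 0) (u10 : u1 != 0).
Variable x : K.
Hypothesis x0 : x != 0.

Local Notation q := (qh ^+ 2).
Local Notation a := (k1 * u1).
Local Notation c := (qh * k0 * u0).
Local Notation d := (- (qh * k0 * u0^-1)).
Local Notation gpol := (gpol a q).
Local Notation upol := (upol a q).
Local Notation wpol := (wpol a q).
Local Notation lev := (lev h).

Let q0 : q != 0. Proof. exact: expf_neq0. Qed.
Let K00 : h k0 != 0. Proof. by rewrite fmorph_eq0. Qed.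
Let K10 : h k1 != 0. Proof. by rewrite fmorph_eq0. Qed.
Let U00 : h u0 != 0. Proof. by rewrite fmorph_eq0. Qed.
Let U10 : h u1 != 0. Proof. by rewrite fmorph_eq0. Qed.

(** The right-hand side of [T1E] at a point of an arbitrary field; [lev_T0] plays the same role for
    [T0E]. *)
Definition lev_T1 (f : laurent F) : K :=
  h k1 * lev f x +
  h k1^-1 * ((1 - h (k1 * u1) * x) * (1 + h (k1 / u1) * x) / (1 - x ^+ 2)) *
  (lev f x^-1 - lev f x).

Definition lev_T0 (f : laurent F) : K :=
  h k0 * lev f x +
  h k0^-1 *
    ((1 - h (qh * k0 * u0) * x^-1) * (1 + h (qh * k0 / u0) * x^-1) /
     (1 - h (qh ^+ 2) * x ^- 2)) *
  (lev f (h (qh ^+ 2) * x^-1) - lev f x).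

Lemma lev_T1_lin e (f g : laurent F) :
  lev_T1 (e *: f + g) = h e * lev_T1 f + lev_T1 g.
Proof. by rewrite /lev_T1 !levD !levZ; ring. Qed.

Lemma lev_T0_lin e (f g : laurent F) :
  lev_T0 (e *: f + g) = h e * lev_T0 f + lev_T0 g.
Proof. by rewrite /lev_T0 !levD !levZ; ring. Qed.

Lemma lev_T1_gpol0 : lev_T1 (gpol 0) = lev (k1 *: gpol 0) x.
Proof. by rewrite /lev_T1 levZ !lev_gpol0 subrr mulr0 addr0. Qed.

(** By [upol_sym], (1 - ax)(u_k(1/x) - u_k(x)) = a(x - 1/x) u_k(x), so the denominator 1 - x^2
    cancels. Together with [lev_T1_wpol] this shows that T_1 preserves the span of u_k and w_k. *)
Lemma lev_T1_upol k : 1 - x ^+ 2 != 0 ->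
  lev_T1 (upol k) = lev (- (k1 * q ^+ k.+1)^-1 *: wpol k) x.
Proof.
move=> D; rewrite /lev_T1 levZ lev_wpol //.
have := upol_sym a q h k x0.
have Q0 : h q ^+ k.+1 != 0 by rewrite -rmorphXn fmorph_eq0 expf_neq0.
rewrite !(rmorphM, fmorphV, rmorphN, rmorphXn) /= in Q0 *.
move: (lev _ _) (lev _ _) (_ ^+ k.+1) Q0 => g f Q Q0.
move: (h k1) (h u1) K10 U10 => K1 U1 K10' U10' e.
transitivity (K1 * g + K1^-1 * (1 + K1 / U1 * x) / (1 - x ^+ 2) *
  ((1 - K1 * U1 * x) * f - (1 - K1 * U1 * x) * g)).
  by field; rewrite D K10' U10'.
by rewrite e; field; rewrite D K10' U10' x0 Q0.
Qed.

Lemma lev_T1_wpol k : 1 - x ^+ 2 != 0 -> lev_T1 (wpol k) =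
  lev ((k1 - k1^-1) *: wpol k - (k1 * q ^+ k.+1) *: upol k) x.
Proof.
move=> D; rewrite /lev_T1 levB !levZ.
rewrite !lev_wpol ?invr_neq0 // invrK.
have := upol_sym a q h k x0.
rewrite !(rmorphM, fmorphV, rmorphB, rmorphXn) /=.
move: (lev _ _) (lev _ _) (_ ^+ k.+1) => g f Q.
move: (h k1) (h u1) K10 U10 => K1 U1 K10' U10' e.
transitivity (K1 * (K1 * U1 * Q * x^-1 * g) +
  K1^-1 * (1 + K1 / U1 * x) / (1 - x ^+ 2) * (K1 * U1 * Q) *
  (x * ((1 - K1 * U1 * x) * f) - x^-1 * (1 - K1 * U1 * x) * g)).
  by field; rewrite D K10' U10' x0.
by rewrite e; field; rewrite D K10' U10' x0.
Qed.

Lemma lev_T0_gpol k : lev_T0 (gpol k) = lev (k0 *: gpol k) x.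
Proof. by rewrite /lev_T0 levZ gpol_sym // subrr mulr0 addr0. Qed.

(** As g_k is invariant under x -> q/x, only the factor 1 - aq^k x changes, and the denominator
    cancels to leave (1 - c/x)(1 - d/x) aq^k x g_k. The coefficient of g_k is found by setting x =
    1/(aq^k), where u_k/g_k and g_(k+1)/g_k vanish. *)
Lemma lev_T0_upol k : x ^+ 2 - h q != 0 -> lev_T0 (upol k) =
  lev (- k0^-1 *: upol k + k0 *: gpol k.+1 +
  (k0^-1 * ((1 - a * c * q ^+ k) * (1 - a * d * q ^+ k))) *: gpol k) x.
Proof.
move=> D; rewrite /lev_T0 !levD !levZ.
have QX : h q * x^-1 != 0.
  by rewrite mulf_neq0 ?invr_neq0 // fmorph_eq0.
rewrite lev_gpolS // !lev_upol // gpol_sym // [_ ^+ k.+1]exprS.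
rewrite !(rmorphM, fmorphV, rmorphN, rmorphXn, rmorphB, rmorph1) /= in D *.
move: (lev _ _) ((h qh ^+ 2) ^+ k) => g Z.
move: (h k0) (h u0) (h qh) K00 U00 D => K0 U0 Q k0' u0' D.
by field; rewrite D k0' u0' x0.
Qed.
End AbstractOperators.

(** * Transfer to the operators on Laurent polynomials *)

Section Operators.
Context {F : fieldType}.
Variables qh k0 k1 u0 u1 : F.
Hypotheses (qh0 : qh != 0) (k00 : k0 != 0) (k10 : k1 != 0)
           (u00 : u0 != 0) (u10 : u1 != 0).

Local Notation q := (qh ^+ 2).
Local Notation a := (k1 * u1).
Local Notation c := (qh * k0 * u0).
Local Notation d := (- (qh * k0 * u0^-1)).
Local Notation T1 := (T1 k1 u1).
Local Notation T0 := (T0 qh k0 u0).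
Local Notation gpol := (gpol a q).
Local Notation upol := (upol a q).
Local Notation wpol := (wpol a q).

Let rat : {rmorphism F -> ratfun F} := @FracField.tofrac {poly F} \o polyC.

Lemma sqr_ratX_neqC e : ratX ^+ 2 != ratC e :> ratfun F.
Proof.
rewrite /ratX /ratC /= -rmorphXn /= tofrac_eq.
apply/eqP => /(congr1 (fun p : {poly F} => size p)).
by rewrite size_polyXn size_polyC; case: (e != 0).
Qed.

Let D1 : 1 - ratX ^+ 2 != 0 :> ratfun F.
Proof. by rewrite subr_eq0 eq_sym -ratC1 sqr_ratX_neqC. Qed.

Let Dq : ratX ^+ 2 - rat q != 0 :> ratfun F.
Proof. by rewrite subr_eq0 sqr_ratX_neqC. Qed.

(** A Laurent polynomial is determined by its value at the generic point [ratX], so the pointwise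
    formulas above become operator identities. *)
Lemma T1_eq (f g : laurent F) :
  lev_T1 rat k1 u1 ratX f = lev rat g ratX -> T1 f = g.
Proof. by move=> e; apply: lsubstX_inj; rewrite /= T1E. Qed.

Lemma T0_eq (f g : laurent F) :
  lev_T0 rat qh k0 u0 ratX f = lev rat g ratX -> T0 f = g.
Proof. by move=> e; apply: lsubstX_inj; rewrite /= T0E. Qed.

Lemma T1_lev (f : laurent F) : lev rat (T1 f) ratX = lev_T1 rat k1 u1 ratX f.
Proof. exact: T1E. Qed.

Lemma T0_lev (f : laurent F) : lev rat (T0 f) ratX = lev_T0 rat qh k0 u0 ratX f.
Proof. exact: T0E. Qed.

Lemma T1_linear e (f g : laurent F) : T1 (e *: f + g) = e *: T1 f + T1 g.
Proof. by apply: T1_eq; rewrite lev_T1_lin levD levZ !T1_lev. Qed.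

Lemma T0_linear e (f g : laurent F) : T0 (e *: f + g) = e *: T0 f + T0 g.
Proof. by apply: T0_eq; rewrite lev_T0_lin levD levZ !T0_lev. Qed.

Lemma T1_gpol0 : T1 (gpol 0) = k1 *: gpol 0.
Proof. exact/T1_eq/lev_T1_gpol0. Qed.

Lemma T1_upol k : T1 (upol k) = - (k1 * q ^+ k.+1)^-1 *: wpol k.
Proof. exact/T1_eq/lev_T1_upol/D1/ratX_neq0. Qed.

Lemma T1_wpol k :
  T1 (wpol k) = (k1 - k1^-1) *: wpol k - (k1 * q ^+ k.+1) *: upol k.
Proof. exact/T1_eq/lev_T1_wpol/D1/ratX_neq0. Qed.

Lemma T0_gpol k : T0 (gpol k) = k0 *: gpol k.
Proof. exact/T0_eq/lev_T0_gpol/ratX_neq0. Qed.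

Lemma T0_upol k : T0 (upol k) = - k0^-1 *: upol k + k0 *: gpol k.+1 +
  (k0^-1 * ((1 - a * c * q ^+ k) * (1 - a * d * q ^+ k))) *: gpol k.
Proof. exact/T0_eq/lev_T0_upol/Dq/ratX_neq0. Qed.
End Operators.

(** * Triangularity of the basis, its leading coefficients and its values at 1/a *)

Section Coefficients.
Context {F : fieldType}.
Variables a q : F.
Local Notation gpol := (gpol a q).
Local Notation upol := (upol a q).
Local Notation wpol := (wpol a q).

Lemma mcoeff_upol k j :
  (upol k)@_j = (gpol k)@_j - a * q ^+ k * (gpol k)@_(j - 1).
Proof. by rewrite upolE mcoeffB mcoeffZ mcoeff_mulxz. Qed.

Lemma mcoeff_wpol k j : (wpol k)@_j = a * q ^+ k.+1 * (upol k)@_(j + 1).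
Proof. by rewrite wpolE mcoeffZ mcoeff_mulxz opprK. Qed.

Lemma mcoeff_gpolS k j : (gpol k.+1)@_j = (upol k)@_j - (wpol k)@_j.
Proof. by rewrite gpolS mcoeffB. Qed.

Lemma mcoeff_gpol_eq0 k (j : int) :
  (j < - k%:Z) || (k%:Z < j) -> (gpol k)@_j = 0.
Proof.
elim: k j => [|k IH] j jk.
  by rewrite gpol0 mcoeffU; case: eqP jk => [<-|//]; rewrite ltxx.
rewrite mcoeff_gpolS mcoeff_wpol !mcoeff_upol !IH; try lia.
by rewrite !(mulr0, subr0).
Qed.

Lemma mcoeff_upol_eq0 k (j : int) :
  (j < - k%:Z) || (k.+1%:Z < j) -> (upol k)@_j = 0.
Proof.
by move=> jk; rewrite mcoeff_upol !mcoeff_gpol_eq0 ?mulr0 ?subr0 //; lia.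
Qed.

Lemma mcoeff_gpol_top k : (gpol k)@_k%:Z = \prod_(i < k) - (a * q ^+ i).
Proof.
elim: k => [|k IH]; first by rewrite gpol0 mcoeffU big_ord0.
rewrite big_ord_recr -IH /= mcoeff_gpolS mcoeff_wpol.
rewrite [X in _ - _ * X]mcoeff_upol_eq0; last lia.
rewrite mulr0 subr0 mcoeff_upol [X in X - _]mcoeff_gpol_eq0; last lia.
rewrite (_ : k.+1%:Z - 1 = k%:Z); last lia.
by rewrite add0r mulrN mulrC.
Qed.

Lemma mcoeff_gpol_bot k :
  (gpol k)@_(- k%:Z) = \prod_(i < k) - (a * q ^+ i.+1).
Proof.
elim: k => [|k IH]; first by rewrite gpol0 mcoeffU big_ord0.
rewrite big_ord_recr -IH /= mcoeff_gpolS mcoeff_wpol.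
rewrite [X in X - _]mcoeff_upol_eq0; last lia.
rewrite (_ : - k.+1%:Z + 1 = - k%:Z); last lia.
rewrite mcoeff_upol [X in _ * (_ - _ * X)]mcoeff_gpol_eq0; last lia.
by rewrite mulr0 subr0 add0r mulrN mulrC.
Qed.

(* Positions in the ordering 1, x^-1, x, x^-2, x^2, ... *)
Definition mon_pos (j : int) : nat :=
  if (0 <= j)%R then `|j|.*2 else `|j|.*2.-1.

Definition pos_mon (n : nat) : int :=
  if odd n then - (n./2.+1)%:Z else n./2%:Z.

Lemma mon_lt_pos j m : mon_lt j m = (mon_pos j < mon_pos m)%N.
Proof. by rewrite /mon_lt /mon_pos; case: ifP => ?; case: ifP => ?; lia. Qed.

Lemma mon_posK : cancel mon_pos pos_mon.
Proof.
by move=> j; rewrite /mon_pos; case: ifP => ?; rewrite /pos_mon; case: ifP; lia.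
Qed.

Lemma pos_monK : cancel pos_mon mon_pos.
Proof.
move=> n; rewrite /pos_mon; case: ifP => on; rewrite /mon_pos.
  have -> : (0 <= - n./2.+1%:Z) = false by lia.
  lia.
by rewrite /=; lia.
Qed.

(** The exponents of g_k lie in [-k, k] and those of w_k in [-k-1, k]; interleaving them makes x^k
    and x^(-k-1), at positions 2k and 2k+1, the top monomials. *)
Definition epol n : laurent F := if odd n then wpol n./2 else gpol n./2.

Lemma mcoeff_epol_eq0 n j : (n < mon_pos j)%N -> (epol n)@_j = 0.
Proof.
rewrite /mon_pos /epol; case: ifP => ?; case: ifP => ? jn;
  rewrite ?mcoeff_wpol ?mcoeff_gpol_eq0 ?mcoeff_upol_eq0 ?mulr0 //; lia.
Qed.

Definition elead n : F :=
  if odd n then a * q ^+ n./2.+1 * \prod_(i < n./2) - (a * q ^+ i.+1)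
  else \prod_(i < n./2) - (a * q ^+ i).

Lemma mcoeff_epol_top n : (epol n)@_(pos_mon n) = elead n.
Proof.
rewrite /epol /pos_mon /elead; case: ifP => ?; last exact: mcoeff_gpol_top.
rewrite mcoeff_wpol (_ : - _ + 1 = - n./2%:Z); last lia.
rewrite mcoeff_upol mcoeff_gpol_bot mcoeff_gpol_eq0; last lia.
by rewrite mulr0 subr0.
Qed.

Lemma elead_neq0 n : a != 0 -> q != 0 -> elead n != 0.
Proof.
move=> a0 q0; rewrite /elead; case: ifP => _.
  rewrite !mulf_neq0 ?expf_neq0 //.
  by apply/prodf_neq0 => i _; rewrite oppr_eq0 mulf_neq0 ?expf_neq0.
by apply/prodf_neq0 => i _; rewrite oppr_eq0 mulf_neq0 ?expf_neq0.
Qed.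

Local Notation ev := (lev idfun).

Lemma lev_upol_inv k : a != 0 -> ev (upol k) a^-1 = 0.
Proof.
move=> a0; have ai0 : a^-1 != 0 by rewrite invr_neq0.
elim: k => [|k IH].
  by rewrite lev_upol //= expr0 mulr1 divff // subrr mul0r.
by rewrite lev_upol // lev_gpolS // IH !mulr0.
Qed.

(** Every member except g_0 is a multiple of some u_k, which contains the factor 1 - ax. *)
Lemma lev_epol_inv n : a != 0 -> ev (epol n) a^-1 = (n == 0%N)%:R.
Proof.
move=> a0; have ai0 : a^-1 != 0 by rewrite invr_neq0.
rewrite /epol; case: ifP => on.
  by rewrite lev_wpol // lev_upol_inv // mulr0; case: n on.
case: n on => [|n] on; first by rewrite lev_gpol0.
rewrite (_ : n.+1./2 = n./2.+1); last lia.
by rewrite lev_gpolS // lev_upol_inv // mulr0.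
Qed.
End Coefficients.

(** * Bidiagonal form of the eigenvalue equation and its explicit solution *)

Section Spectral.
Context {F : fieldType}.
Variables qh k0 k1 u0 u1 : F.
Hypotheses (qh0 : qh != 0) (k00 : k0 != 0) (k10 : k1 != 0)
           (u00 : u0 != 0) (u10 : u1 != 0).

Local Notation q := (qh ^+ 2).
Local Notation a := (k1 * u1).
Local Notation c := (qh * k0 * u0).
Local Notation d := (- (qh * k0 * u0^-1)).
Local Notation T1 := (T1 k1 u1).
Local Notation T0 := (T0 qh k0 u0).
Local Notation Y := (Yop qh k0 k1 u0 u1).
Local Notation gpol := (gpol a q).
Local Notation upol := (upol a q).
Local Notation wpol := (wpol a q).
Local Notation epol := (epol a q).

Let q0 : q != 0. Proof. exact: expf_neq0. Qed.
Let a0 : a != 0. Proof. exact: mulf_neq0. Qed.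
Let T1D (f g : laurent F) : T1 (f + g) = T1 f + T1 g.
Proof. by rewrite -[f]scale1r T1_linear !scale1r. Qed.
Let T10 : T1 0 = 0.
Proof. by apply: (addIr (T1 0)); rewrite -T1D !add0r. Qed.
Let T1Z e (f : laurent F) : T1 (e *: f) = e *: T1 f.
Proof. by rewrite -[e *: f]addr0 T1_linear T10 addr0. Qed.
Let T1B (f g : laurent F) : T1 (f - g) = T1 f - T1 g.
Proof. by rewrite -!scaleN1r T1D T1Z. Qed.
Let T0D (f g : laurent F) : T0 (f + g) = T0 f + T0 g.
Proof. by rewrite -[f]scale1r T0_linear // !scale1r. Qed.
Let T00 : T0 0 = 0.
Proof. by apply: (addIr (T0 0)); rewrite -T0D !add0r. Qed.
Let T0Z e (f : laurent F) : T0 (e *: f) = e *: T0 f.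
Proof. by rewrite -[e *: f]addr0 T0_linear // T00 addr0. Qed.
Let T0B (f g : laurent F) : T0 (f - g) = T0 f - T0 g.
Proof. by rewrite -!scaleN1r T0D T0Z. Qed.

Lemma YD (f g : laurent F) : Y (f + g) = Y f + Y g.
Proof. by rewrite /Yop T0D T1D. Qed.

Lemma YZ e (f : laurent F) : Y (e *: f) = e *: Y f.
Proof. by rewrite /Yop T0Z T1Z. Qed.

(** The inverse of T_1 read off from the Hecke relation (T_1 - k1)(T_1 + k1^-1) = 0; [T1K_epol]
    checks it on the basis. *)
Definition T1inv (f : laurent F) : laurent F := T1 f - (k1 - k1^-1) *: f.

Lemma T1inv0 : T1inv 0 = 0.
Proof. by rewrite /T1inv T10 scaler0 subrr. Qed.

Lemma T1inv_lin e (f g : laurent F) :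
  T1inv (e *: f + g) = e *: T1inv f + T1inv g.
Proof.
rewrite /T1inv T1_linear //.
move: (T1 f) (T1 g) => f' g'; apply/malgP => j.
rewrite !(mcoeffD, mcoeffN, mcoeffZ). ring.
Qed.

Lemma T1K_upol k : T1 (T1inv (upol k)) = upol k.
Proof.
rewrite /T1inv T1B T1Z !T1_upol // T1Z T1_wpol //.
apply/malgP => j; rewrite !(mcoeffD, mcoeffN, mcoeffZ).
have := expf_neq0 k.+1 q0; move: (q ^+ k.+1) => Q Q0.
by field; rewrite k10 Q0.
Qed.

Lemma T1K_wpol k : T1 (T1inv (wpol k)) = wpol k.
Proof.
rewrite /T1inv T1B T1Z !T1_wpol // T1B !T1Z T1_wpol // T1_upol //.
apply/malgP => j; rewrite !(mcoeffD, mcoeffN, mcoeffZ).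
have := expf_neq0 k.+1 q0; move: (q ^+ k.+1) => Q Q0.
by field; rewrite k10 Q0.
Qed.

Lemma T1K_gpol0 : T1 (T1inv (gpol 0)) = gpol 0.
Proof.
rewrite /T1inv T1B T1Z !T1_gpol0 // T1Z T1_gpol0 //.
by apply/malgP => j; rewrite !(mcoeffD, mcoeffN, mcoeffZ); field.
Qed.

(** g_(k+1) = u_k - w_k lies in a plane preserved by T_1, and g_0 is an eigenvector. *)
Lemma T1K_epol n : T1 (T1inv (epol n)) = epol n.
Proof.
rewrite /epol; case: ifP => on; first exact: T1K_wpol.
case: (n./2) => [|k]; first exact: T1K_gpol0.
have -> : T1inv (gpol k.+1) = T1inv (upol k) - T1inv (wpol k).
  by rewrite gpolS addrC -scaleN1r T1inv_lin scaleN1r addrC.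
by rewrite T1B T1K_upol T1K_wpol gpolS.
Qed.

Variable gam : F.

(* Y f = gam f amounts to Lop f = 0; unlike Y - gam, the operator Lop is
   bidiagonal from the basis [epol] to the basis [hpol]. *)
Definition Lop (f : laurent F) : laurent F := T0 f - gam *: T1inv f.

Definition hpol n : laurent F := if odd n then upol n./2 else gpol n./2.

(** Vanishes exactly when [gam] is the spectral value of the monomial at position n. *)
Definition Ldiag n : F :=
  if odd n then gam * (k1 * q ^+ n./2.+1) - k0^-1
  else k0 - gam / (k1 * q ^+ n./2).

(** The index is that of the target: [Loff n] is the coefficient of [hpol n] in the image of
    [epol n.+1]. *)
Definition Loff n : F :=
  if odd n then gam / (k1 * q ^+ n./2.+1) * (1 - q ^+ n./2.+1) *
                (1 + k1 ^+ 2 * q ^+ n./2.+1)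
  else k0^-1 * ((1 - a * c * q ^+ n./2) * (1 - a * d * q ^+ n./2)).

Lemma Lop_lin e (f g : laurent F) : Lop (e *: f + g) = e *: Lop f + Lop g.
Proof.
rewrite /Lop T0_linear // T1inv_lin.
move: (T0 f) (T0 g) (T1inv f) (T1inv g) => f0 g0 f1 g1; apply/malgP => j.
by rewrite !(mcoeffD, mcoeffN, mcoeffZ); ring.
Qed.

Lemma Lop_epol0 : Lop (epol 0) = Ldiag 0 *: hpol 0.
Proof.
rewrite /Lop /T1inv /epol /hpol /Ldiag /= T0_gpol // T1_gpol0 //.
by apply/malgP => j; rewrite !(mcoeffD, mcoeffN, mcoeffZ) expr0; field.
Qed.

(** For w_k = u_k - g_(k+1), the g_(k+1) terms of T_0 cancel and T_1^-1 w_k is a multiple of u_k.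
    For g_(k+1), T_0 acts by k0, and T_1^-1 stays in the span of u_k and w_k, hence of u_k and
    g_(k+1). *)
Lemma Lop_epolS n :
  Lop (epol n.+1) = Ldiag n.+1 *: hpol n.+1 + Loff n *: hpol n.
Proof.
rewrite /Lop /T1inv /epol /hpol /Ldiag /Loff /=.
case: ifP => [on|en].
  have -> : uphalf n = n./2 by lia.
  have -> /= : odd n = false by lia.
  move: (n./2) => k.
  have e : wpol k = upol k - gpol k.+1 by rewrite gpolS opprB addrC subrK.
  rewrite T1_wpol // {1}e T0B T0_upol // T0_gpol // e.
  apply/malgP => j; rewrite !(mcoeffD, mcoeffN, mcoeffZ).
  move: (_ * (_ * _)) => s.
  have := expf_neq0 k.+1 q0; move: (q ^+ k.+1) => Q Q0.
  by field; rewrite u00 k00 k10.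
have -> : uphalf n = n./2.+1 by lia.
have -> /= : odd n by lia.
move: (n./2) => k.
have e : wpol k = upol k - gpol k.+1 by rewrite gpolS opprB addrC subrK.
have -> : T1 (gpol k.+1) = T1 (upol k) - T1 (wpol k) by rewrite -T1B -gpolS.
rewrite T0_gpol // T1_upol // T1_wpol // e.
apply/malgP => j; rewrite !(mcoeffD, mcoeffN, mcoeffZ).
have := expf_neq0 k.+1 q0; move: (q ^+ k.+1) => Q Q0.
by field; rewrite k10 Q0.
Qed.

(** Solves c_n [Ldiag n] + c_(n+1) [Loff n] = 0 downwards from c_N = 1. *)
Definition evec_coef N n : F := \prod_(n <= i < N) - (Loff i / Ldiag i).

Definition evec N : laurent F := \sum_(n < N.+1) evec_coef N n *: epol n.

Lemma Lop_sum I (s : seq I) (E : I -> F) (G : I -> laurent F) :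
  Lop (\sum_(i <- s) E i *: G i) = \sum_(i <- s) E i *: Lop (G i).
Proof.
elim: s => [|i s IH]; last by rewrite !big_cons Lop_lin IH.
rewrite !big_nil; apply: (addIr (Lop 0)).
by rewrite -{1}[Lop 0]scale1r -Lop_lin scaler0 !add0r.
Qed.

Lemma Lop_evec N : Ldiag N = 0 -> (forall n, (n < N)%N -> Ldiag n != 0) ->
  Lop (evec N) = 0.
Proof.
move=> lN ln; rewrite /evec Lop_sum big_ord_recl /= Lop_epol0.
under eq_bigr => i _ do rewrite /bump add1n Lop_epolS scalerDr.
(* Collect the coefficient of each [hpol n]: for n < N it is the two-term recursion, and for n = N
   only [Ldiag N] = 0 remains. *)
rewrite big_split /= addrA.
rewrite -(big_ord_recl N (fun n => evec_coef N n *: (Ldiag n *: hpol n))).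
rewrite big_ord_recr /= lN scale0r scaler0 addr0 -big_split big1 //= => i _.
rewrite !scalerA -scalerDl (_ : _ + _ = 0) ?scale0r //.
rewrite {1}/evec_coef big_ltn // -/(evec_coef N i.+1).
by have l0 := ln _ (ltn_ord i); field.
Qed.

Lemma T1K_evec N : T1 (T1inv (evec N)) = evec N.
Proof.
rewrite /evec; elim/big_ind: _ => [|f g ef eg|n _].
- by rewrite T1inv0 T10.
- by rewrite -[f]scale1r T1inv_lin T1_linear ef eg.
by rewrite -[_ *: _]addr0 T1inv_lin T1_linear T1K_epol T1inv0 T10.
Qed.

(** [Lop] E = 0 says T_0 E = gam T_1^-1 E; applying T_1 gives the eigenvalue equation. *)
Lemma Y_evec N : Ldiag N = 0 -> (forall n, (n < N)%N -> Ldiag n != 0) ->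
  Y (evec N) = gam *: evec N.
Proof.
move=> lN ln; have /eqP := Lop_evec lN ln.
by rewrite /Lop subr_eq0 /Yop => /eqP->; rewrite T1Z T1K_evec.
Qed.

Lemma mcoeff_evec N j :
  (evec N)@_j = \sum_(n < N.+1) evec_coef N n * (epol n)@_j.
Proof.
by rewrite /evec raddf_sum /=; apply: eq_bigr => n _; rewrite mcoeffZ.
Qed.

Lemma mcoeff_evec_eq0 N j : (N < mon_pos j)%N -> (evec N)@_j = 0.
Proof.
move=> Nj; rewrite mcoeff_evec big1 // => n _.
rewrite mcoeff_epol_eq0 ?mulr0 //.
by have := ltn_ord n; lia.
Qed.

Lemma mcoeff_evec_top N : (evec N)@_(pos_mon N) = elead a q N.
Proof.
rewrite mcoeff_evec big_ord_recr /= big1 ?add0r => [|n _].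
  by rewrite /evec_coef big_geq // mul1r mcoeff_epol_top.
by rewrite mcoeff_epol_eq0 ?mulr0 // pos_monK.
Qed.

Lemma lev_evec N : lev idfun (evec N) a^-1 = evec_coef N 0.
Proof.
rewrite /evec big_ord_recl /= levD levZ lev_epol_inv //= mulr1.
rewrite /lev raddf_sum big1 ?addr0 //= => n _.
by rewrite -/(lev idfun _ _) levZ lev_epol_inv //= mulr0.
Qed.
End Spectral.

(** * Identification of P with the explicit eigenvector *)

Section Evaluation.
Context {F : fieldType}.
Variables qh k0 k1 u0 u1 : F.
Hypotheses (qh0 : qh != 0) (k00 : k0 != 0) (k10 : k1 != 0)
           (u00 : u0 != 0) (u10 : u1 != 0).
Local Notation q := (qh ^+ 2).
Local Notation a := (k1 * u1).

Let q0 : q != 0. Proof. exact: expf_neq0. Qed.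
Let a0 : a != 0. Proof. exact: mulf_neq0. Qed.

Variables (m : int) (P : laurent F).
Hypothesis nsP : is_nsAW qh k0 k1 u0 u1 m P.
Let gam := spectral q k0 k1 m.
Let N := mon_pos m.

Lemma Ldiag_mon_pos : Ldiag qh k0 k1 gam N = 0.
Proof.
rewrite /gam /N /Ldiag /spectral /mon_pos; case: m => n /=.
  rewrite odd_double doubleK -[_ ^ _]/(q ^+ n).
  by have := expf_neq0 n q0; move: (_ ^+ n) => Q Q0; field; rewrite k10 Q0.
rewrite /= odd_double /= uphalf_double -[_ ^ _]/(q ^- n.+1).
have := expf_neq0 n.+1 q0; move: (_ ^+ n.+1) => Q Q0.
by field; rewrite k00 k10 Q0.
Qed.

Lemma Ldiag_neq0 n : (n < N)%N -> Ldiag qh k0 k1 gam n != 0.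
Proof.
move=> nN; apply/eqP => ln.
(* The least zero is chosen because the coefficients of [evec n'] divide by all earlier diagonal
   entries. *)
have [n' /andP[/eqP ln' n'N] nmin] :
    {n' | (Ldiag qh k0 k1 gam n' == 0) && (n' < N)%N &
      forall i, (i < n')%N -> Ldiag qh k0 k1 gam i != 0}.
  have ex : exists i, (Ldiag qh k0 k1 gam i == 0) && (i < N)%N.
    by exists n; rewrite ln eqxx.
  case: (ex_minnP ex) => n' h hmin; exists n' => // i lti.
  apply: contraL (lti) => l0; rewrite -leqNgt; apply: hmin; rewrite l0.
  by case/andP: h => _; lia.
have [[[mP sP] eP] uniP] := nsP.
have eE := Y_evec qh0 k00 k10 u00 u10 ln' nmin.
set E := evec _ _ _ _ _ _ _ in eE.
(* E only involves positions up to n' < N, so P + E is again monic with the same eigenvalue.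
   Uniqueness forces E to vanish, against its nonzero coefficient at position n'. *)
have /(congr1 (fun f : laurent F => f@_(pos_mon n'))) : P = P + E.
  apply: uniP; split; last by rewrite YD // eP eE scalerDr.
  split=> [|j].
    by rewrite mcoeffD mP mcoeff_evec_eq0 ?addr0.
  rewrite mcoeffD; have [Pj|/sP//] := eqVneq P@_j 0.
  rewrite Pj add0r => Ej; right; rewrite mon_lt_pos.
  apply: leq_ltn_trans n'N; rewrite leqNgt; apply: contraNN Ej => h.
  by rewrite mcoeff_evec_eq0.
move/eqP; rewrite mcoeffD mcoeff_evec_top -subr_eq0 opprD addrA subrr add0r.
by rewrite oppr_eq0; apply/negP/elead_neq0.
Qed.

(** By uniqueness P is [evec] over its leading coefficient, and at 1/a only the coefficient of g_0
    is left. *)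
Lemma leval_nsAW : leval P a^-1 =
  (elead a q N)^-1 *
  \prod_(0 <= i < N) - (Loff qh k0 k1 u0 u1 gam i / Ldiag qh k0 k1 gam i).
Proof.
have eE := Y_evec qh0 k00 k10 u00 u10 Ldiag_mon_pos Ldiag_neq0.
have -> : P = (elead a q N)^-1 *: evec qh k0 k1 u0 u1 gam N.
  have l0 := elead_neq0 N a0 q0.
  have [_ uniP] := nsP; apply: uniP; split.
    split=> [|j].
      by rewrite mcoeffZ -[X in _@_X]mon_posK mcoeff_evec_top mulVf.
    rewrite mcoeffZ mulf_eq0 negb_or => /andP[_ Ej].
    have : (mon_pos j <= N)%N.
      by rewrite leqNgt; apply: contraNN Ej => h; rewrite mcoeff_evec_eq0.
    rewrite leq_eqVlt => /orP[/eqP e|]; last by rewrite mon_lt_pos; right.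
    by left; apply: (can_inj mon_posK).
  by rewrite YZ // eE !scalerA mulrC.
rewrite -[leval _ _]/(lev idfun _ _) levZ; congr (_ * _).
exact: lev_evec.
Qed.
End Evaluation.

(** * Reindexing of finite products *)

Section Products.
Context {F : fieldType}.

Lemma big_nat_double (f : nat -> F) m :
  \prod_(0 <= i < m.*2) f i = \prod_(k < m) (f k.*2 * f k.*2.+1).
Proof.
elim: m => [|m IH]; first by rewrite big_geq // big_ord0.
by rewrite doubleS !big_nat_recr //= IH big_ord_recr /= mulrA.
Qed.

Lemma prod_div_rev (y : nat -> F) m : (forall k, (k < m)%N -> y k != 0) ->
  \prod_(k < m) (y k / y (m - k.+1)%N) = 1.
Proof.
move=> y0; rewrite prodf_div (reindex_inj rev_ord_inj) /= divff //.
by apply/prodf_neq0 => k _; apply: y0; have := ltn_ord k; lia.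
Qed.

(** The factors 1 - q^(k+1) of [Loff] and 1 - q^(m-k) of [Ldiag] cancel only after reversing the
    order; this product isolates that cancellation. *)
Lemma prod_qint_rev (q : F) m : q != 0 ->
  (forall k, (k < m)%N -> 1 - q ^+ k.+1 != 0) ->
  \prod_(k < m) ((1 - q ^+ k.+1) / q ^+ k /
                 ((1 - q ^+ (m - k)) / q ^+ (m - k.+1))) = 1.
Proof.
move=> q0 hq.
rewrite -[RHS](@prod_div_rev (fun k => (1 - q ^+ k.+1) / q ^+ k) m).
  by apply: eq_bigr => k _; rewrite -subSn ?ltn_ord // subSS.
by move=> k km; rewrite mulf_neq0 ?hq ?invr_neq0 ?expf_neq0.
Qed.
End Products.

(** * Closed forms for the two signs of the index *)

Section Formulas.
Context {F : fieldType}.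
Variables qh k0 k1 u0 u1 : F.
Hypotheses (qh0 : qh != 0) (k00 : k0 != 0) (k10 : k1 != 0)
           (u00 : u0 != 0) (u10 : u1 != 0).
Local Notation q := (qh ^+ 2).
Local Notation a := (k1 * u1).
Local Notation c := (qh * k0 * u0).
Local Notation d := (- (qh * k0 * u0^-1)).

Let q0 : q != 0. Proof. exact: expf_neq0. Qed.
Let a0 : a != 0. Proof. exact: mulf_neq0. Qed.

Lemma spectral_nat n : spectral q k0 k1 n%:Z = k0 * k1 * q ^+ n.
Proof. by []. Qed.

Lemma spectral_neg n : spectral q k0 k1 (- n.+1%:Z) = (k0 * k1)^-1 / q ^+ n.+1.
Proof. by []. Qed.

Lemma mon_pos_nat n : mon_pos n%:Z = n.*2.
Proof. by []. Qed.

Lemma mon_pos_neg n : mon_pos (- n.+1%:Z) = n.*2.+1.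
Proof. by []. Qed.

(** For gam = k0 k1 q^m the even diagonal entries are k0(1 - q^(m-k)), and the odd ones are -1/k0
    times the factors of the denominator q-shifted factorial. *)
Lemma leval_nsAW_nonneg (m : nat) (P : laurent F) :
  is_nsAW qh k0 k1 u0 u1 m%:Z P ->
  leval P a^-1 = a ^- m *
    (qpoch q (- (q * k1 ^+ 2)) m * qpoch q (a * c) m * qpoch q (a * d) m /
     qpoch q (q ^+ m.+1 * k0 ^+ 2 * k1 ^+ 2) m).
Proof.
move=> nsP; rewrite (leval_nsAW qh0 k00 k10 u00 u10 nsP).
have := Ldiag_neq0 qh0 k00 k10 u00 u10 nsP.
rewrite mon_pos_nat spectral_nat => l0.
(* The diagonal entry at 2(m-k-1) equals k0(1 - q^(k+1)). *)
have hq k : (k < m)%N -> 1 - q ^+ k.+1 != 0.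
  move=> km; have : ((m - k.+1).*2 < m.*2)%N by lia.
  move/l0; rewrite /Ldiag odd_double doubleK; apply: contraNneq => e.
  rewrite (_ : q ^+ m = q ^+ (m - k.+1) * q ^+ k.+1); last first.
    by rewrite -exprD; congr (_ ^+ _); lia.
  move/eqP: e; rewrite subr_eq0 => /eqP<-; rewrite mulr1.
  have := expf_neq0 (m - k.+1) q0; move: (_ ^+ (m - _)) => Q Q0.
  by apply/eqP; field; rewrite k10 Q0.
rewrite /elead odd_double doubleK big_nat_double /qpoch.
rewrite -prodfV -exprVn (_ : a^-1 ^+ m = \prod_(k < m) a^-1); last first.
  by rewrite prodr_const card_ord.
rewrite -!big_split -prodfV -!big_split /=.
(* With this product equal to 1 inserted, the two sides agree factor by factor. *)
rewrite -[RHS]mulr1 -[X in _ = _ * X](prod_qint_rev q0 hq) -big_split /=.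
apply: eq_bigr => k _.
have km := ltn_ord k.
have /l0 h0 : (k.*2 < m.*2)%N by lia.
have /l0 h1 : (k.*2.+1 < m.*2)%N by lia.
move: h0 h1; rewrite /Loff /Ldiag /= odd_double /= doubleK uphalf_double.
rewrite (_ : q ^+ (m - k) = q * q ^+ (m - k.+1)); last first.
  by rewrite -exprS; congr (_ ^+ _); lia.
rewrite ![q ^+ _.+1]exprS.
rewrite (_ : q ^+ m = q ^+ k * (q * q ^+ (m - k.+1))); last first.
  by rewrite -exprS -exprD; congr (_ ^+ _); lia.
move: (1 - a * c * _) (1 - a * d * _) => S1 S2.
have := expf_neq0 k q0; have := expf_neq0 (m - k.+1) q0; have := q0.
move: (qh ^+ 2) (q ^+ k) (q ^+ (m - k.+1)) => Q K M Q0 M0 K0 h0 h1.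
have {}h0 : k0 - k0 * (Q * M) != 0.
  by apply: contraNneq h0 => <-; apply/eqP; field; rewrite k10 K0.
have h0' : 1 - Q * M != 0.
  by apply: contraNneq h0 => e; rewrite -[X in X - _]mulr1 -mulrBr e mulr0.
have {}h1 : k0 * k1 * (K * (Q * M)) * (k1 * (Q * K)) * k0 - 1 != 0.
  apply: contraNneq h1 => e.
  by rewrite -(mulfK k00 (_ - _)) mulrBl mulVf // e mul0r.
have h1' : 1 - Q * (K * (Q * M)) * k0 ^+ 2 * k1 ^+ 2 * K != 0.
  by apply: contraNneq h1 => e; rewrite -oppr_eq0 -{}e; apply/eqP; ring.
by field; rewrite M0 h0' K0 h1' u10 k10 k00 h1 Q0 h0 oppr_eq0 mulf_neq0.
Qed.

(** Here the parities swap roles: the odd diagonal entries are k0^-1 (1 - q^(p-k))/q^(p-k), and the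
    even ones carry the denominator factors [D k]. *)
Lemma leval_nsAW_neg (p : nat) (P : laurent F) : 1 + k1 ^- 2 != 0 ->
  is_nsAW qh k0 k1 u0 u1 (- p.+1%:Z) P ->
  leval P a^-1 = a ^- p.+1 / (1 + k1 ^- 2) *
    (qpoch q (- k1 ^+ 2) p.+1 * qpoch q (a * c) p.+1 * qpoch q (a * d) p.+1 /
     qpoch q (q ^+ p.+1 * k0 ^+ 2 * k1 ^+ 2) p.+1).
Proof.
move=> hk1 nsP; rewrite (leval_nsAW qh0 k00 k10 u00 u10 nsP).
have := Ldiag_neq0 qh0 k00 k10 u00 u10 nsP.
rewrite mon_pos_neg spectral_neg => l0.
have hq k : (k < p)%N -> 1 - q ^+ k.+1 != 0.
  move=> km; have : ((p - k.+1).*2.+1 < p.*2.+1)%N by lia.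
  move/l0; rewrite /Ldiag /= odd_double uphalf_double; apply: contraNneq => e.
  rewrite (_ : q ^+ p.+1 = q ^+ (p - k.+1).+1 * q ^+ k.+1); last first.
    by rewrite -exprD; congr (_ ^+ _); lia.
  move/eqP: e; rewrite subr_eq0 => /eqP<-; rewrite mulr1.
  have := expf_neq0 (p - k.+1).+1 q0; move: (_ ^+ (p - _).+1) => Q Q0.
  by apply/eqP; field; rewrite k10 k00 Q0.
pose S1 k := 1 - a * c * q ^+ k.
pose S2 k := 1 - a * d * q ^+ k.
pose B k := 1 + k1 ^+ 2 * q ^+ k.+1.
pose D k := 1 - q ^+ p.+1 * k0 ^+ 2 * k1 ^+ 2 * q ^+ k.
have hD k : (k <= p)%N -> k0 - (k0 * k1)^-1 / q ^+ p.+1 / (k1 * q ^+ k) =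
    - D k / (k0 * k1 ^+ 2 * q ^+ p.+1 * q ^+ k).
  move=> kp; rewrite /D.
  have := expf_neq0 p.+1 q0; have := expf_neq0 k q0.
  move: (q ^+ p.+1) (q ^+ k) => Q K K0 Q0.
  by field; rewrite k10 k00 K0 Q0.
have D0 k : (k <= p)%N -> D k != 0.
  move=> kp; have : (k.*2 < p.*2.+1)%N by lia.
  move/l0; rewrite /Ldiag odd_double doubleK hD //.
  by apply: contraNneq => ->; rewrite oppr0 mul0r.
(* The 2p+1 ratios form p pairs and one last ratio of even index 2p, which absorbs the extra factor
   a q^(p+1) of [elead]. *)
transitivity (
  (\prod_(k < p) (a^-1 * (S1 k * S2 k) * B k / D k * q^-1 *
     ((1 - q ^+ k.+1) / q ^+ k / ((1 - q ^+ (p - k)) / q ^+ (p - k.+1))))) *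
  (a^-1 * k1 ^+ 2 * q ^+ p * (S1 p * S2 p) / D p)).
  rewrite /elead /= odd_double uphalf_double big_nat_recr //= big_nat_double.
  rewrite invfM -prodfV [X in X * _]mulrC mulrACA -big_split /=; congr (_ * _).
    apply: eq_bigr => k _.
    have km := ltn_ord k.
    have /l0 : (k.*2.+1 < p.*2.+1)%N by lia.
    rewrite /Loff /Ldiag /= odd_double /= doubleK uphalf_double.
    rewrite hD ?(ltnW km) //; have := D0 k (ltnW km); rewrite -/(S1 k) -/(S2 k).
    move: (D k) (S1 k) (S2 k) => d s1 s2.
    rewrite (_ : q ^+ (p - k) = q * q ^+ (p - k.+1)); last first.
      by rewrite -exprS; congr (_ ^+ _); lia.
    rewrite /B ![q ^+ _.+1]exprS.
    rewrite (_ : q ^+ p = q ^+ k * (q * q ^+ (p - k.+1))); last first.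
      by rewrite -exprS -exprD; congr (_ ^+ _); lia.
    have := expf_neq0 k q0; have := expf_neq0 (p - k.+1) q0; have := q0.
    move: (qh ^+ 2) (q ^+ k) (q ^+ (p - k.+1)) => Q K M Q0 M0 K0 d0 h1.
    have {}h1 : 1 - Q * M != 0.
      apply: contraNneq h1 => e; apply/eqP.
      transitivity (k0^-1 * (1 - Q * M) / (Q * M)).
        by field; rewrite k10 k00 K0 M0 Q0.
      by rewrite e mulr0 mul0r.
    by field; rewrite M0 h1 K0 Q0 d0 u10 k10 k00 !oppr_eq0 d0 ?mulf_neq0.
  rewrite /Loff /Ldiag /= odd_double /= doubleK.
  rewrite hD //; have := D0 p (leqnn p); rewrite -/(S1 p) -/(S2 p).
  move: (D p) (S1 p) (S2 p) => d s1 s2 d0.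
  rewrite ![q ^+ _.+1]exprS.
  have := expf_neq0 p q0; have := q0; move: (qh ^+ 2) (q ^+ p) => Q K Q0 K0.
  by field; rewrite u10 k10 k00 Q0 K0 !oppr_eq0 d0 ?mulf_neq0.
rewrite big_split /= (prod_qint_rev q0 hq) mulr1 !big_split /= !prodfV.
rewrite !prodr_const !card_ord.
(* The first factor 1 + k1^2 of this q-shifted factorial, divided by 1 + k1^-2, leaves k1^2; the
   others are split at their last factor. *)
rewrite /qpoch [\prod_(i < p.+1) (1 - - _ * _)]big_ord_recl.
rewrite ![\prod_(i < p.+1) _]big_ord_recr /= -/(S1 p) -/(S2 p) -/(D p).
rewrite -/(\prod_(k < p) S1 k) -/(\prod_(k < p) S2 k) -/(\prod_(k < p) D k).
have -> : \prod_(i < p) (1 - - k1 ^+ 2 * q ^+ bump 0 i) = \prod_(k < p) B k.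
  by apply: eq_bigr => k _; rewrite /B /bump add1n mulNr opprK.
rewrite expr0 mulr1 opprK [a ^+ p.+1]exprS.
have := D0 p (leqnn p).
have : \prod_(k < p) D k != 0.
  by apply/prodf_neq0 => k _; apply: D0; have := ltn_ord k; lia.
have := expf_neq0 p a0; have := expf_neq0 p q0.
move: (\prod_(k < p) D k) (D p) (S1 p) (S2 p) (q ^+ p) (a ^+ p) => PD d s1 s2.
move: (\prod_(k < p) S1 k) (\prod_(k < p) S2 k) (\prod_(k < p) B k) => P1 P2 PB.
move=> Q A Q0 A0 PD0 d0.
have hk1' : k1 ^+ 2 + 1 != 0.
  apply: contraNneq hk1 => e; apply/eqP.
  transitivity ((k1 ^+ 2 + 1) / k1 ^+ 2); last by rewrite e mul0r.
  by field.
by field; rewrite d0 PD0 k10 hk1' A0 u10 Q0.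
Qed.
End Formulas.

(** * Both evaluations, in the original and in the Askey-Wilson parameters *)

Theorem proposition10p2 (R : realType) (q qh k0 k1 u0 u1 : R[i])
    (hq0 : q != 0) (hq1 : `|q| != 1) (hqh : qh ^+ 2 = q)
    (hk0 : k0 != 0) (hk1 : k1 != 0) (hu0 : u0 != 0) (hu1 : u1 != 0)
    (gk0 : avoids_qpowers q (k0 ^+ 2))
    (gk1 : avoids_qpowers q (k1 ^+ 2))
    (gu1 : avoids_qpowers q (u1 ^+ 2)) :
  let a := k1 * u1 in
  let b := - (k1 * u1^-1) in
  let c := qh * k0 * u0 in
  let d := - (qh * k0 * u0^-1) in
  (forall (m : nat) (P : laurent R[i]),
      is_nsAW qh k0 k1 u0 u1 m%:Z P ->
      leval P (k1^-1 * u1^-1) =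
        k1 ^- m * u1 ^- m *
        (qpoch3 q (- (q * k1 ^+ 2)) (qh * k0 * k1 * u0 * u1)
                (- (qh * k0 * k1 * u0^-1 * u1)) m /
         qpoch q (q ^+ m.+1 * k0 ^+ 2 * k1 ^+ 2) m)
      /\
      leval P (k1^-1 * u1^-1) =
        a ^- m *
        (qpoch3 q (q * a * b) (a * c) (a * d) m /
         qpoch q (q ^+ m * a * b * c * d) m))
  /\
  (forall (m : nat) (P : laurent R[i]),
      (0 < m)%N ->
      is_nsAW qh k0 k1 u0 u1 (- m%:Z) P ->
      leval P (k1^-1 * u1^-1) =
        k1 ^- m * u1 ^- m / (1 + k1 ^- 2) *
        (qpoch3 q (- k1 ^+ 2) (qh * k0 * k1 * u0 * u1)
                (- (qh * k0 * k1 * u0^-1 * u1)) m /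
         qpoch q (q ^+ m * k0 ^+ 2 * k1 ^+ 2) m)
      /\
      leval P (k1^-1 * u1^-1) =
        a ^- m / (1 - a^-1 * b^-1) *
        (qpoch3 q (a * b) (a * c) (a * d) m /
         qpoch q (q ^+ m.-1 * a * b * c * d) m)).
Proof.
have qh0 : qh != 0 by apply: contraNneq hq0 => e; rewrite -hqh e expr0n.
subst q => a b c d.
(* Dictionary between the parameters: ab = -k1^2 and cd = -q k0^2 give abcd = q k0^2 k1^2, whence
   the shift by one in the exponents of q. *)
have ac : a * c = qh * k0 * k1 * u0 * u1 by rewrite /a /c; ring.
have ad : a * d = - (qh * k0 * k1 * u0^-1 * u1) by rewrite /a /d; ring.
have ab : a * b = - k1 ^+ 2 by rewrite /a /b; field.
have cd : c * d = - (qh ^+ 2 * k0 ^+ 2) by rewrite /c /d; field.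
have ai : k1^-1 * u1^-1 = a^-1 by rewrite invfM.
have am m : k1 ^- m * u1 ^- m = a ^- m by rewrite exprMn invfM.
split=> [m P nsP|[//|p] P _ nsP]; rewrite ai am /qpoch3.
  rewrite (leval_nsAW_nonneg qh0 hk0 hk1 hu0 hu1 nsP) -/a -/c -/d.
  rewrite -ac -ad (_ : qh ^+ 2 * a * b = - (qh ^+ 2 * k1 ^+ 2)); last first.
    by rewrite -mulrA ab; ring.
  rewrite (_ : _ * a * b * c * d = qh ^+ 2 ^+ m * (a * b) * (c * d)); last first.
    by ring.
  rewrite ab cd; split=> //; congr (_ * (_ / qpoch _ _ _)).
  by rewrite [qh ^+ 2 ^+ m.+1]exprS; ring.
(* The case j = 0 of [gk1] gives k1^2 different from -1. *)
have k1p : 1 + k1 ^- 2 != 0.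
  have [_] := gk1 0; rewrite expr0z; apply: contraNneq => e.
  apply/eqP; transitivity (k1 ^+ 2 * (1 + k1 ^- 2) - 1); first by field.
  by rewrite e mulr0 sub0r.
rewrite (leval_nsAW_neg qh0 hk0 hk1 hu0 hu1 k1p nsP) -/a -/c -/d.
rewrite -ac -ad (_ : 1 - a^-1 * b^-1 = 1 + k1 ^- 2); last first.
  by rewrite -invfM ab invrN opprK.
rewrite ab; split=> //.
rewrite (_ : _ * a * b * c * d = qh ^+ 2 ^+ p * (a * b) * (c * d)); last first.
  by rewrite /=; ring.
rewrite ab cd; congr (_ * (_ / qpoch _ _ _)).
by rewrite [qh ^+ 2 ^+ p.+1]exprS; ring.
Qed.
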